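(* Let $p$ be a prime and $q=2^p$. Then the minimal simple group $\mathrm{PSL}_2(q)$ can be covered by the solvabilizers of $q-1$ involutions. In particular, $\alpha_{inv}(\mathrm{PSL}_2(q))=\alpha(\mathrm{PSL}_2(q))=q-1$.
   Context: For a finite group $G$, $R(G)$ denotes the solvable radical of $G$ (the largest solvable normal subgroup). For $x\in G$, the solvabilizer of $x$ is $\mathrm{Sol}_G(x)=\{y\in G\mid \langle x,y\rangle \text{ is solvable}\}$. For nonsolvable $G$, a solvabilizer covering of $G$ is a set $X\subset G\setminus R(G)$ such that $G=\bigcup_{x\in X}\mathrm{Sol}_G(x)$, and the solvabilizer number $\alpha(G)$ is the minimum cardinality of a solvabilizer covering of $G$. An involutionary solvabilizer covering is a solvabilizer covering consisting of involutions (elements of order $2$), and $\alpha_{inv}(G)$ is the minimum cardinality of an involutionary solvabilizer covering of $G$ ($\alpha_{inv}(G)=\infty$ if none exists). A minimal simple group is a nonabelian simple group all of whose proper subgroups are solvable. *)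

(* Defs.v *)
From HB Require Import structures.
From mathcomp Require Import all_boot all_order all_algebra all_fingroup all_solvable.

Set Implicit Arguments.
Unset Strict Implicit.
Unset Printing Implicit Defensive.

Import GroupScope GRing.Theory.

Section Solvabilizers.

Variable gT : finGroupType.
Implicit Types (G H : {group gT}) (X Y : {set gT}) (x y : gT).

(* The join of all solvable normal subgroups; [sol_radicalP] below shows that
   it is the largest solvable normal subgroup. *)
Definition sol_radical (G : {group gT}) : {set gT} :=
  <<\bigcup_(H : {group gT} | (H <| G) && solvable H) H>>.

Canonical sol_radical_group G := Eval hnf in [group of sol_radical G].

Definition solvabilizer (G : {group gT}) x : {set gT} :=
  [set y in G | solvable <<[set x; y]>>].

Definition sol_covering (G : {group gT}) X : bool :=
  (X \subset G :\: sol_radical G) &&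
  (G :==: \bigcup_(x in X) solvabilizer G x).

Definition inv_sol_covering (G : {group gT}) X : bool :=
  sol_covering G X && [forall x in X, #[x] == 2].

(* [None] stands for infinity: no set satisfies P. *)
Definition min_card (P : pred {set gT}) : option nat :=
  omap (fun X : {set gT} => #|X|)
       [pick X | P X && [forall Y, P Y ==> (#|X| <= #|Y|)]].

(* Used for nonsolvable G. A covering X cannot be empty, since 1 \in G, so
   G :\: sol_radical G is nonempty: a solvable G has no covering at all. *)
Definition sol_number (G : {group gT}) : option nat :=
  min_card (sol_covering G).

Definition inv_sol_number (G : {group gT}) : option nat :=
  min_card (inv_sol_covering G).

Lemma sol_radicalP G :
  [/\ sol_radical G <| G, solvable (sol_radical G)
    & forall H, H <| G -> solvable H -> H \subset sol_radical G].
Proof.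
have max_sub H : H <| G -> solvable H -> H \subset sol_radical G.
  move=> nHG solH; apply: sub_gen.
  by apply: (bigcup_sup H); rewrite ?nHG.
have [R maxR _] : {R : {group gT} | [max R | (R <| G) && solvable R]
                                    & [1 gT] \subset R}.
  by apply: maxgroup_exists; rewrite normal1 solvable1.
have [/andP[nRG solR] Rmax] := maxgroupP maxR.
suffices defR : sol_radical G = R by split=> //; rewrite defR.
apply/eqP; rewrite eqEsubset max_sub // andbT gen_subG.
apply/bigcupsP=> H /andP[nHG solH].
have nRH : H \subset 'N(R) := subset_trans (normal_sub nHG) (normal_norm nRG).
have <- : (R <*> H)%G = R :> {set gT}; last exact: joing_subr.
apply: Rmax; last exact: joing_subl.
rewrite /= normalY //= (@series_sol _ _ R).
  by rewrite solR quotientYidl // quotient_sol.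
by rewrite /normal joing_subl join_subG normG.
Qed.

Lemma min_cardP (P : pred {set gT}) n :
  min_card P = Some n <->
  (exists2 X, P X & #|X| = n) /\ (forall X, P X -> n <= #|X|).
Proof.
rewrite /min_card; case: pickP => [X /andP[PX /forallP minX] | noX] /=; split.
- by case=> <-; split=> [|Y PY]; [exists X | apply: (implyP (minX Y))].
- case=> [[Y PY <-] minY]; congr Some; apply/eqP.
  by rewrite eqn_leq minY // (implyP (minX Y)).
- by [].
case=> [[X PX <-] minX]; have /andP[] := noX X; split=> //.
by apply/forallP=> Y; apply/implyP; apply: minX.
Qed.

End Solvabilizers.

Section ProjectiveSpecialLinear.

Variables (n : nat) (F : finFieldType).

(* For n > 0 only: the matrices underlying {'GL_n[F]} have size n.-1.+1. *)
Definition SL : {set {'GL_n[F]}} := [set u | \det (GLval u) == 1]%R.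

Lemma SL_group_set : group_set SL.
Proof.
apply/group_setP; split=> [|u v]; rewrite !inE ?GL_1E ?det1 //.
by move=> /eqP du /eqP dv; rewrite GL_ME det_mulmx du dv mulr1.
Qed.

Canonical SL_group := Group SL_group_set.

Definition PSL : {group coset_of 'Z(SL)} := (SL / 'Z(SL))%G.

End ProjectiveSpecialLinear.

(* Main.v *)
(* Upper bound: the transvections u_s = [1 s; 0 1], s != 0, suffice. Given
   y = [a b; c d], if c = 0 then y normalizes the abelian group of all
   transvections; if c != 0, then for s = (a + d) / c the product u_s y has trace
   0, so it squares to 1 in characteristic 2 and <u_s, y> = <u_s, u_s y> is
   generated by two elements of order at most 2 (any s will do when a + d = 0).

   Lower bound: since z |-> z + 1/z is not injective on F, it misses some t, and
   'X^2 + t 'X + 1 is irreducible. At least q(q - 1) elements g of SL_2(q) have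
   trace t, and every x != 1 has at most q of them in its solvabilizer, so at
   least q - 1 solvabilizers are needed. Indeed a minimal normal subgroup of a
   solvable <x, g> is abelian; it cannot be unipotent as g fixes no line, so it is
   centralized by g, hence lies in the torus of g, and x centralizes or inverts g.
   If tr x != 0, then x centralizes g, which is then determined by its (1, 1)
   entry; if tr x = 0, then x inverts g, and such g lie on a conic that can be
   parametrized by F. The same count shows that the solvable radical is trivial. *)
Require Import Defs.
From mathcomp Require Import all_boot all_order all_algebra all_fingroup
  all_solvable.
From mathcomp Require Import finfield ring.

Set Implicit Arguments.
Unset Strict Implicit.
Unset Printing Implicit Defensive.

Import GRing.Theory.
Local Open Scope ring_scope.

(** * Certificates for polynomial consequences of equations *)

Section LinearCombinations.

Variable R : comNzRingType.
Implicit Types (k l r L : R).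

(** With the coefficients [k1], ... given explicitly, deducing an equation from others is left to
    [ring]; characteristic 2 enters as the equation [2 = 0]. *)
Lemma lincomb1 k1 l1 r1 L r : l1 = r1 -> L - r = k1 * (l1 - r1) -> L = r.
Proof. by move=> -> /eqP; rewrite subrr mulr0 subr_eq0 => /eqP. Qed.

Lemma lincomb2 k1 k2 l1 r1 l2 r2 L r : l1 = r1 -> l2 = r2 ->
  L - r = k1 * (l1 - r1) + k2 * (l2 - r2) -> L = r.
Proof. by move=> -> e2; rewrite subrr mulr0 add0r; apply: lincomb1. Qed.

Lemma lincomb3 k1 k2 k3 l1 r1 l2 r2 l3 r3 L r :
  l1 = r1 -> l2 = r2 -> l3 = r3 ->
  L - r = k1 * (l1 - r1) + k2 * (l2 - r2) + k3 * (l3 - r3) -> L = r.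
Proof. by move=> -> e2 e3; rewrite subrr mulr0 add0r; apply: lincomb2. Qed.

Lemma lincomb4 k1 k2 k3 k4 l1 r1 l2 r2 l3 r3 l4 r4 L r :
  l1 = r1 -> l2 = r2 -> l3 = r3 -> l4 = r4 ->
  L - r = k1 * (l1 - r1) + k2 * (l2 - r2) + k3 * (l3 - r3) + k4 * (l4 - r4) ->
  L = r.
Proof. by move=> -> e2 e3 e4; rewrite subrr mulr0 add0r; apply: lincomb3. Qed.

End LinearCombinations.

(** * Solvability of two-generated subgroups *)

Section SolvableGeneration.

Variable gT : finGroupType.
Implicit Types (R : {group gT}) (x y : gT).

(** The product of [R] and [<[y]>] is an extension of [R] by a cyclic group, and it contains both
    generators. *)
Lemma solvable_gen2 R x y : solvable R -> x \in R -> y \in 'N(R)%g ->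
  solvable <<[set x; y]>>%g.
Proof.
move=> solR Rx nRy; have nRY : <[y]>%g \subset 'N(R)%g by rewrite cycle_subG.
apply: (@solvableS _ (R <*> <[y]>)%G).
  rewrite gen_subG subUset !sub1set (subsetP (joing_subl _ _)) //=.
  by rewrite (subsetP (joing_subr _ _)) ?cycle_id.
rewrite (@series_sol _ _ R) /= ?solR ?quotientYidl // ?quotient_sol //.
  by apply/abelian_sol/cycle_abelian.
by rewrite /(_ <| _)%g joing_subl join_subG normG.
Qed.

(* [<x * y>] is normalized by [x], which inverts [x * y]. *)
Lemma solvable_gen_involutions x y : (x * x = 1)%g -> (y * y = 1)%g ->
  solvable <<[set x; y]>>%g.
Proof.
move=> x2 y2; have xV : x^-1%g = x by apply: (mulgI x); rewrite mulgV x2.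
have yV : y^-1%g = y by apply: (mulgI y); rewrite mulgV y2.
have : solvable <<[set (x * y)%g; x]>>%g.
  apply: (@solvable_gen2 <[x * y]>%G); first exact/abelian_sol/cycle_abelian.
    exact: cycle_id.
  rewrite -cycle_subG norms_cycle.
  rewrite conjMg {1}conjgE mulKg conjgE mulKVg.
  rewrite -[X in (X * _)%g]yV -[X in (_ * X)%g]xV -invMg.
  by rewrite groupV cycle_id.
apply: solvableS; rewrite gen_subG subUset !sub1set /=.
set H := <<_>>%g; have Hx : x \in H by rewrite mem_gen // set22.
by rewrite Hx -(mulKg x y) groupM ?groupV // mem_gen // set21.
Qed.

Lemma injm_solvable_gen2 (rT : finGroupType) (D : {group gT})
    (f : {morphism D >-> rT}) x y : ('injm f)%g -> x \in D -> y \in D ->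
  solvable <<[set f x; f y]>>%g = solvable <<[set x; y]>>%g.
Proof.
move=> injf Dx Dy.
have sD : [set x; y] \subset D by rewrite subUset !sub1set Dx.
rewrite -(injm_sol injf) ?gen_subG //=.
by rewrite morphim_gen // morphimU !morphim_set1.
Qed.

End SolvableGeneration.

(** * Entries, determinant and trace of 2 by 2 matrices *)

Section Entries.

Variable F : finFieldType.
Implicit Types (x y g : {'GL_2[F]}) (a b c d : F).

Definition e11 x : F := GLval x ord0 ord0.
Definition e12 x : F := GLval x ord0 ord_max.
Definition e21 x : F := GLval x ord_max ord0.
Definition e22 x : F := GLval x ord_max ord_max.
Definition tr2 x := e11 x + e22 x.

Lemma GL2_eq x y : e11 x = e11 y -> e12 x = e12 y -> e21 x = e21 y ->
  e22 x = e22 y -> x = y.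
Proof.
move=> h11 h12 h21 h22; apply/val_inj/matrixP=> i j.
have ord2 (k : 'I_2) : k = ord0 \/ k = ord_max.
  by case: k => [[|[|k]] lt_k]; [left | right | ]; try exact: val_inj.
by case: (ord2 i) => ->; case: (ord2 j) => ->.
Qed.

Lemma GL2_mulE x y :
  [/\ e11 (x * y)%g = e11 x * e11 y + e12 x * e21 y,
      e12 (x * y)%g = e11 x * e12 y + e12 x * e22 y,
      e21 (x * y)%g = e21 x * e11 y + e22 x * e21 y
    & e22 (x * y)%g = e21 x * e12 y + e22 x * e22 y].
Proof.
have E i j : GLval (x * y)%g i j
    = GLval x i ord0 * GLval y ord0 j + GLval x i ord_max * GLval y ord_max j.
  rewrite GL_MxE mxE big_ord_recl big_ord1.
  by rewrite (_ : lift ord0 ord0 = ord_max) //; apply: val_inj.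
by split; apply: E.
Qed.

Lemma GL2_1E : [/\ e11 1%g = 1, e12 1%g = 0, e21 1%g = 0 & e22 1%g = 1].
Proof. by split; rewrite /e11 /e12 /e21 /e22 GL_1E mxE. Qed.

Lemma det_mx2 (A : 'M[F]_2) :
  \det A = A ord0 ord0 * A ord_max ord_max - A ord0 ord_max * A ord_max ord0.
Proof.
rewrite (expand_det_row _ ord0) big_ord_recl big_ord1 /cofactor !det_mx11 !mxE.
rewrite /= expr0 expr1 mul1r mulN1r mulrN.
by congr (_ * A _ _ - A _ _ * A _ _); apply: val_inj.
Qed.

Lemma SL2P x : reflect (e11 x * e22 x - e12 x * e21 x = 1) (x \in SL 2 F).
Proof. by rewrite inE det_mx2; apply: eqP. Qed.

Definition mx2 a b c d : 'M[F]_2 :=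
  \matrix_(i, j) if i == ord0 then if j == ord0 then a else b
                 else if j == ord0 then c else d.

(** Singular matrices are sent to the default [1]; the lemmas on [gl2] assume determinant 1. *)
Definition gl2 a b c d : {'GL_2[F]} :=
  insubd (1%g : {'GL_2[F]}) (mx2 a b c d).

Lemma gl2E a b c d : a * d - b * c = 1 ->
  [/\ e11 (gl2 a b c d) = a, e12 (gl2 a b c d) = b,
      e21 (gl2 a b c d) = c & e22 (gl2 a b c d) = d].
Proof.
move=> det1; have U : mx2 a b c d \is a GRing.unit.
  by rewrite [_ \is a _]unitmxE det_mx2 !mxE /= det1 unitr1.
have E : GLval (gl2 a b c d) = mx2 a b c d by rewrite /gl2 [LHS]insubdK.
by rewrite /e11 /e12 /e21 /e22 E !mxE.
Qed.

Lemma gl2_SL a b c d : a * d - b * c = 1 -> gl2 a b c d \in SL 2 F.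
Proof.
by move=> det1; apply/SL2P; have [-> -> -> ->] := gl2E det1.
Qed.

Lemma tr2_conj x y : tr2 (x ^ y)%g = tr2 x.
Proof.
have trE z : tr2 z = \tr (GLval z).
  rewrite /mxtrace big_ord_recl big_ord1 /tr2 /e11 /e22; congr (_ + _).
  by congr (GLval z _ _); apply: val_inj.
by rewrite !trE conjgE GL_MxE mxtrace_mulC -GL_MxE mulgK.
Qed.

End Entries.

(** * Characteristic 2: elements without eigenvalues and solvable subgroups containing them *)

Section Char2.

Variable F : finFieldType.
Hypothesis char2 : 2 = 0 :> F.
Implicit Types (x y g : {'GL_2[F]}) (a b c d s t : F).

Lemma addr_eq0_char2 a b : a + b = 0 -> a = b.
Proof.
by move=> ab0; apply: (lincomb2 (k1 := 1) (k2 := - b) ab0 char2); ring.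
Qed.

Lemma sqr_inj_char2 a b : a ^+ 2 = b ^+ 2 -> a = b.
Proof.
move=> ab2; apply: addr_eq0_char2; apply/eqP; rewrite -[_ == 0](expf_eq0 _ 2).
by apply/eqP/(lincomb2 (k1 := 1) (k2 := b ^+ 2 + a * b) ab2 char2); ring.
Qed.

(** This is the characteristic polynomial of an element of [SL 2 F] of trace [t], signs being
    irrelevant; without a root in [F], such an element preserves no line. *)
Definition irreducible_trace t := forall z, z ^+ 2 + t * z + 1 <> 0.

Lemma irreducible_trace_exists : exists t, irreducible_trace t.
Proof.
have /negP ninj : ~~ injectiveb (fun z : F => z + z^-1).
  (* Since [0^-1 = 0] by convention and [1 + 1 = 0], both 0 and 1 are sent to 0. *)
  apply/injectiveP => /(_ 0 1).
  rewrite invr0 invr1 addr0 -[1 + 1]/(2 : F) char2 => /(_ erefl) /esym/eqP.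
  by rewrite oner_eq0.
have [t tP|surj] := pickP [pred t | t \notin codom (fun z : F => z + z^-1)].
  exists t => z zP; case/negP: tP; apply/codomP; exists z.
  have z0 : z != 0.
    apply/eqP=> z0; move: zP; rewrite z0 expr2 !mulr0 !add0r => /eqP.
    by rewrite oner_eq0.
  apply: (mulfI z0); rewrite mulrDr divff //.
  by apply: (lincomb2 (k1 := 1) (k2 := - z ^+ 2 - 1) zP char2); ring.
case: ninj; apply/injectiveP=> u v.
have /image_injP inj : #|codom (fun z : F => z + z^-1)| == #|F|.
  by apply/eqP/eq_card=> z; have /negPn := negbT (surj z).
exact: inj.
Qed.

Lemma irreducible_trace_neq0 t : irreducible_trace t -> t != 0.
Proof.
move=> irr; apply/eqP=> t0; apply: (irr 1).
by rewrite t0; apply: (lincomb1 (k1 := 1) char2); ring.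
Qed.

(** A triangular [g] would have the eigenvalue [e11 g] in [F]. *)
Lemma irreducible_trace_offdiag g : g \in SL 2 F -> irreducible_trace (tr2 g) ->
  e12 g != 0 /\ e21 g != 0.
Proof.
move=> /SL2P dg irr; split; apply/eqP=> g0; apply: (irr (e11 g)); rewrite /tr2.
  apply: (lincomb3 (k1 := -1) (k2 := - e21 g)
    (k3 := e11 g ^+ 2 + e11 g * e22 g) dg g0 char2); ring.
apply: (lincomb3 (k1 := -1) (k2 := - e12 g)
  (k3 := e11 g ^+ 2 + e11 g * e22 g) dg g0 char2); ring.
Qed.

(* [b] stands for [a ^ g]: if [a] were unipotent, [g] would preserve the line
   fixed by [a], and its slope would give an eigenvalue of [g] in [F]. *)
Lemma tr2_normalized_neq0 (a g b : {'GL_2[F]}) :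
  a \in SL 2 F -> b \in SL 2 F -> a != 1%g -> b != 1%g ->
  irreducible_trace (tr2 g) -> g \in SL 2 F -> (g * b = a * g)%g ->
  commute a b -> tr2 b = tr2 a -> tr2 a != 0.
Proof.
move=> Sa Sb a1 b1 irr Sg gb cab trb; apply/eqP=> tra.
have [g12 g21] := irreducible_trace_offdiag Sg irr.
have unip x : x \in SL 2 F -> tr2 x = 0 ->
    e22 x = e11 x /\ (e11 x + 1) ^+ 2 = e12 x * e21 x.
  move=> /SL2P dx trx; have h : e22 x = e11 x.
    by apply: addr_eq0_char2; rewrite addrC.
  split=> //; move: dx; rewrite h => dx.
  apply: (lincomb2 (k1 := 1) (k2 := e11 x + 1) dx char2); ring.
rewrite tra in trb.
have [a22 na] := unip a Sa tra; have [b22 nb] := unip b Sb trb.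
have unip1 x : x \in SL 2 F -> tr2 x = 0 -> e12 x = 0 -> e21 x = 0 -> x = 1%g.
  move=> Sx trx x12 x21; have [x22] := unip x Sx trx.
  rewrite x12 mul0r => /eqP; rewrite expf_eq0 /= => /eqP x11.
  have h : e11 x = 1 by apply: addr_eq0_char2.
  by have [o11 o12 o21 o22] := GL2_1E F; apply: GL2_eq;
    rewrite ?x22 ?h ?x12 ?x21.
have [ab11 _ _ _] := GL2_mulE a b; have [ba11 _ _ _] := GL2_mulE b a.
have [gb11 gb12 _ gb22] := GL2_mulE g b;
  have [ag11 ag12 _ ag22] := GL2_mulE a g.
have cab11 : e12 a * e21 b = e21 a * e12 b.
  have := congr1 (@e11 F) cab; rewrite ab11 ba11 => h.
  by apply: (lincomb1 (k1 := 1) h); ring.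
have := congr1 (@e11 F) gb; rewrite gb11 ag11 => {gb11 ag11} h11.
have := congr1 (@e12 F) gb; rewrite gb12 ag12 b22 => {gb12 ag12} h12.
have := congr1 (@e22 F) gb; rewrite gb22 ag22 a22 b22 => {gb22 ag22} h22.
have [a12|a12] := eqVneq (e12 a) 0.
  (* Here [a] and [b] both fix the line of the column [(0, 1)]; [g] preserves it, which would force
     [e12 g = 0]. *)
  have a21 : e21 a != 0 by apply: contraNneq a1 => /(unip1 a Sa tra a12)->.
  have b12 : e12 b = 0.
    by move: cab11; rewrite a12 mul0r => /esym/eqP;
      rewrite mulf_eq0 (negPf a21) => /eqP.
  have b21 : e21 b != 0 by apply: contraNneq b1 => /(unip1 b Sb trb b12)->.
  have m1 x : (e11 x + 1) ^+ 2 = e12 x * e21 x -> e12 x = 0 -> e11 x = 1.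
    move=> nx x12; move/eqP: nx; rewrite x12 mul0r expf_eq0 /= => /eqP.
    exact: addr_eq0_char2.
  move: h11; rewrite (m1 a) // (m1 b) // a12 => h11.
  have /eqP : e12 g * e21 b = 0 by apply: (lincomb1 (k1 := 1) h11); ring.
  by rewrite mulf_eq0 (negPf g12) (negPf b21).
have b12 : e12 b != 0.
  apply: contraNneq b1 => b12; apply/eqP/unip1 => //; apply: (mulfI a12).
  by rewrite cab11 b12 !mulr0.
(* The column [(p, r)] of [b + 1] spans the line fixed by [b]. By [key], [g] maps it into the line
   fixed by [a]; by [key2], the two lines coincide. *)
pose p := e12 b; pose r := e11 b + 1.
have key : (e11 g * p + e12 g * r) * (e11 a + 1)
    = (e21 g * p + e22 g * r) * e12 a.
  apply: (lincomb3 (k1 := e11 a + 1) (k2 := - e12 a) (k3 := e12 g) h12 h22 na).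
  by rewrite /p /r; ring.
have key2 : p * (e11 a + 1) = r * e12 a.
  apply: sqr_inj_char2; apply: (lincomb3 (k1 := p ^+ 2) (k2 := - e12 a ^+ 2)
    (k3 := - e12 a * p) na nb cab11).
  by rewrite /p /r; ring.
(* The common fixed line is spanned by [(1, s)], and [g] acts on it with eigenvalue
   [e11 g + e12 g * s]. *)
pose s := (e11 a + 1) / e12 a.
have sa : s * e12 a = e11 a + 1 by rewrite divfK.
rewrite -sa mulrA in key2; move/(mulIf a12): key2 => rE.
rewrite -sa mulrA in key; move/(mulIf a12): key; rewrite -rE => K.
apply: (irr (e11 g + e12 g * s)); rewrite /tr2.
have {}K : (e11 g + e12 g * s) * s = e21 g + e22 g * s.
  apply: (mulfI b12); rewrite -/p; apply: (lincomb1 (k1 := 1) K); ring.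
move/SL2P: Sg => dg.
apply: (lincomb3 (k1 := e12 g) (k2 := (e11 g + e22 g) * (e11 g + e12 g * s))
  (k3 := -1) K char2 dg).
ring.
Qed.

(* The second case is that [y] inverts [a], expressed by entries. *)
Lemma normalize_tr2_neq0 (a y b : {'GL_2[F]}) :
  a \in SL 2 F -> b \in SL 2 F -> tr2 a != 0 ->
  (y * b = a * y)%g -> commute a b -> tr2 b = tr2 a ->
  commute a y \/
  [/\ tr2 y = 0 & e12 a * e21 y + e21 a * e12 y = tr2 a * e11 y].
Proof.
move=> /SL2P da /SL2P db ta yb cab trb.
have [_ ab12 ab21 _] := GL2_mulE a b; have [_ ba12 ba21 _] := GL2_mulE b a.
(* Commuting with [a] makes the off-diagonal entries of [b] those of [a] times [tr2 b / tr2 a],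
   which is 1. *)
have b12 : e12 b = e12 a.
  have := congr1 (@e12 F) cab; rewrite ab12 ba12 => h.
  apply: (mulIf ta); rewrite -{2}trb /tr2.
  by apply: (lincomb2 (k1 := 1) (k2 := e12 b * e22 a - e12 a * e22 b) h char2);
    ring.
have b21 : e21 b = e21 a.
  have := congr1 (@e21 F) cab; rewrite ab21 ba21 => h.
  apply: (mulIf ta); rewrite -{2}trb /tr2.
  by apply: (lincomb2 (k1 := -1) (k2 := e21 b * e22 a - e21 a * e22 b) h
    char2); ring.
(* Trace and determinant agree as well, so the diagonals agree up to order: [b] is [a] or its
   adjugate, that is, its inverse. *)
have /eqP : (e11 b - e11 a) * (e11 b - e22 a) = 0.
  rewrite b12 b21 in db.
  by apply: (lincomb3 (k1 := -1) (k2 := 1) (k3 := e11 b) db da trb);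
    rewrite /tr2; ring.
rewrite mulf_eq0 !subr_eq0 => /orP[] /eqP b11; move: trb; rewrite /tr2 b11.
  move=> /addrI b22; left; rewrite /commute -yb; congr (_ * _)%g; exact: GL2_eq.
rewrite addrC => /addIr b22; right.
have [yb11 _ _ yb22] := GL2_mulE y b; have [ay11 _ _ ay22] := GL2_mulE a y.
have := congr1 (@e11 F) yb; rewrite yb11 ay11 b11 b21 => h11.
have := congr1 (@e22 F) yb; rewrite yb22 ay22 b22 b12 => h22.
(* Given [tr2 y = 0], the other relation expresses that [a * y] has trace 0. *)
split; last first.
  by apply: (lincomb2 (k1 := -1) (k2 := e12 y * e21 a - e11 a * e11 y) h11
    char2); rewrite /tr2; ring.
apply: (mulIf ta); rewrite mul0r /tr2.
apply: (lincomb3 (k1 := 1) (k2 := 1) (k3 := e11 y * e11 a + e22 y * e22 a) h11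
  h22 char2); ring.
Qed.

(** Commuting matrices have proportional off-diagonal entries and diagonal differences, and in
    characteristic 2 the diagonal difference is the trace. *)
Lemma commute_tr2 (a y : {'GL_2[F]}) : commute a y ->
  e12 y * tr2 a = e12 a * tr2 y /\ e21 y * tr2 a = e21 a * tr2 y.
Proof.
move=> cay; have [_ ay12 ay21 _] := GL2_mulE a y.
have [_ ya12 ya21 _] := GL2_mulE y a; rewrite /tr2; split.
  have := congr1 (@e12 F) cay; rewrite ay12 ya12 => h.
  by apply: (lincomb2 (k1 := 1) (k2 := e12 y * e22 a - e12 a * e22 y) h char2);
    ring.
have := congr1 (@e21 F) cay; rewrite ay21 ya21 => h.
by apply: (lincomb2 (k1 := -1) (k2 := e21 y * e22 a - e21 a * e22 y) h char2);
  ring.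
Qed.

(* Either [x] commutes with [g], or [x] is an involution inverting [g]. *)
Lemma solvable_irreducible (x g : {'GL_2[F]}) : x \in SL 2 F -> g \in SL 2 F ->
    irreducible_trace (tr2 g) -> solvable <<[set x; g]>>%g ->
  [/\ e12 g * tr2 x = e12 x * tr2 g & e21 g * tr2 x = e21 x * tr2 g]
  \/ [/\ tr2 x = 0 & e12 x * e21 g + e21 x * e12 g = tr2 g * e11 x].
Proof.
move=> Sx Sg irr; set H := <<_>>%g => solH.
have tg := irreducible_trace_neq0 irr.
have g1 : g != 1%g.
  have [g12 _] := irreducible_trace_offdiag Sg irr.
  by apply: contraNneq g12 => ->; have [_ -> _ _] := GL2_1E F.
have [Hx Hg] : x \in H /\ g \in H.
  by split; apply: mem_gen; rewrite !inE eqxx ?orbT.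
have sHS : H \subset SL 2 F by rewrite gen_subG subUset !sub1set Sx Sg.
have ntH : H :!=: 1%g by apply/trivgPn; exists g.
have [A minA sAH] : {A : {group {'GL_2[F]}} | minnormal A H & A \subset H}.
  by apply: mingroup_exists; rewrite ntH normG.
have [nAH ntA /abelem_abelian cAA] := minnormal_solvable minA sAH solH.
have [a Aa a1] := trivgPn _ ntA.
have Sa z : z \in A -> z \in SL 2 F.
  by move=> Az; apply/(subsetP sHS)/(subsetP sAH).
have Aconj z : z \in H -> (a ^ z)%g \in A.
  by move=> Hz; rewrite memJ_norm // (subsetP nAH).
have conjE z : (z * a ^ z = a * z)%g by rewrite conjgE mulKVg.
have cconj z : z \in H -> commute a (a ^ z)%g.
  by move=> Hz; apply: (centsP cAA) => //; apply: Aconj.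
(* Both [a] and [a ^ g] lie in the abelian group [A], so they commute and [a] cannot be
   unipotent. *)
have ta : tr2 a != 0.
  apply: (tr2_normalized_neq0 (Sa _ Aa) (Sa _ (Aconj _ Hg)) a1 _ irr Sg
    (conjE g) (cconj g Hg) (tr2_conj a g)).
  by rewrite conjg_eq1.
have norm z (Hz : z \in H) := normalize_tr2_neq0 (Sa _ Aa) (Sa _ (Aconj z Hz))
  ta (conjE z) (cconj z Hz) (tr2_conj a z).
(* Inverting [a] would require [tr2 g = 0]. *)
have /commute_tr2[ga12 ga21] : commute a g.
  by case: (norm g Hg) => // -[/eqP]; rewrite (negPf tg).
(* The off-diagonal entries of [g] are proportional to those of [a], so the relations between [x]
   and [a] carry over to [g] after cancelling [tr2 a]. *)
have [/commute_tr2[xa12 xa21] | [trx xa]] := norm x Hx; [left | right].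
  split; apply: (mulIf ta).
    by apply: (lincomb2 (k1 := tr2 x) (k2 := - tr2 g) ga12 xa12); ring.
  by apply: (lincomb2 (k1 := tr2 x) (k2 := - tr2 g) ga21 xa21); ring.
split=> //; apply: (mulIf ta).
by apply: (lincomb3 (k1 := e12 x) (k2 := e21 x) (k3 := tr2 g) ga21 ga12 xa);
  ring.
Qed.

(** * Counting elements of irreducible trace *)

Lemma card_irreducible_solvabilizer (x : {'GL_2[F]}) t :
  irreducible_trace t -> x \in SL 2 F -> x != 1%g ->
  (#|[set g in SL 2 F | (tr2 g == t) && solvable <<[set x; g]>>%g]| <= #|F|)%N.
Proof.
move=> irr Sx x1; set S := [set g in _ | _].
have tN0 := irreducible_trace_neq0 irr.
(* Trace, determinant and the relations with [x] leave one parameter in [F]; which one depends on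
   [x]. *)
suff [f injf] : exists f : {'GL_2[F]} -> F, {in S &, injective f}.
  by rewrite -(card_in_imset injf) max_card.
have SP g : g \in S ->
    [/\ e11 g * e22 g - e12 g * e21 g = 1, e22 g = t - e11 g &
  [/\ e12 g * tr2 x = e12 x * t & e21 g * tr2 x = e21 x * t]
  \/ [/\ tr2 x = 0 & e12 x * e21 g + e21 x * e12 g = t * e11 x]].
  rewrite inE => /andP[Sg /andP[/eqP trg solg]].
  split; [exact/SL2P | by rewrite -trg /tr2 addrC addKr |].
  rewrite -trg; apply: solvable_irreducible => //; by rewrite trg.
have [trx|trx] := eqVneq (tr2 x) 0; last first.
  exists (@e11 F) => g h /SP[_ g22 Eg] /SP[_ h22 Eh] gh.
  case: Eg => [] [g12 g21]; last by rewrite g12 eqxx in trx.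
  case: Eh => [] [h12 h21]; last by rewrite h12 eqxx in trx.
  by apply: GL2_eq; rewrite ?g22 ?h22 ?gh //; apply: (mulIf trx);
    rewrite ?g12 ?g21.
have x22 : e22 x = e11 x by apply: addr_eq0_char2; rewrite addrC.
move/SL2P: (Sx); rewrite x22 => dx.
have x12x21 : e12 x = 0 -> e11 x = 1 /\ e21 x != 0.
  move=> x12; have x11 : e11 x = 1.
    by apply: sqr_inj_char2; rewrite expr1n -dx x12 mul0r subr0.
  split=> //; apply: contraNneq x1 => x21; have [o11 o12 o21 o22] := GL2_1E F.
  by apply/eqP/GL2_eq; rewrite ?x22 ?x11 ?x12 ?x21.
(* For [tr2 x = 0] the commuting alternative would give [e12 x = e21 x = 0], hence [x = 1]. *)
have {}SP g : g \in S ->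
  [/\ e11 g * e22 g - e12 g * e21 g = 1, e22 g = t - e11 g &
  e12 x * e21 g + e21 x * e12 g = t * e11 x].
  case/SP=> dg g22 [] [] //; rewrite trx mulr0 => /esym/eqP.
  rewrite mulf_eq0 (negPf tN0) orbF => /eqP /x12x21[_ x21].
  rewrite mulr0 => /esym/eqP; by rewrite mulf_eq0 (negPf tN0) (negPf x21).
have [x12|x12] := eqVneq (e12 x) 0.
  have [x11 x21] := x12x21 x12.
  (* The linear relation fixes [e12 g], which is nonzero, and the determinant then gives [e21 g]
     from [e11 g]. *)
  exists (@e11 F) => g h /SP[dg g22 Eg] /SP[dh h22 Eh] gh.
  move: Eg Eh; rewrite x12 x11 !mul0r !add0r mulr1 => Eg Eh.
  have g12 : e12 g != 0 by apply: contraNneq tN0 => g12; rewrite -Eg g12 mulr0.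
  have gh12 : e12 g = e12 h by apply: (mulfI x21); rewrite Eg.
  apply: GL2_eq; rewrite ?g22 ?h22 ?gh //; apply: (mulfI g12).
  by apply: (lincomb2 (k1 := -1) (k2 := 1) dg dh); rewrite g22 h22 gh gh12;
    ring.
pose s g := e12 g / e12 x.
have sE g : e12 g = s g * e12 x by rewrite divfK.
(* In these coordinates the conic [S] becomes [s^2 = w^2 + t w + 1], so that [w]
   determines [s]. *)
have conic g (w := e11 g + e11 x * s g) : g \in S ->
    s g ^+ 2 = w ^+ 2 + t * w + 1.
  case/SP=> dg g22 Eg; rewrite (sE g) in dg Eg; rewrite g22 in dg.
  apply: (lincomb4 (k1 := -1) (k2 := - s g) (k3 := - s g ^+ 2)
    (k4 := - e11 g ^+ 2 - s g * t * e11 x - 1 - e11 g * e11 x * s g) dg Eg dx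
      char2).
  by rewrite /w; ring.
exists (fun g => e11 g + e11 x * s g) => g h Sg Sh wE.
have sgh : s g = s h by apply: sqr_inj_char2; rewrite !conic // wE.
have gh12 : e12 g = e12 h by rewrite (sE g) (sE h) sgh.
have gh11 : e11 g = e11 h by move: wE; rewrite sgh => /addIr.
have [_ g22 Eg] := SP g Sg; have [_ h22 Eh] := SP h Sh.
apply: GL2_eq; rewrite ?g22 ?h22 ?gh11 //; apply: (mulfI x12).
by apply: (addIr (e21 x * e12 g)); rewrite Eg gh12 Eh.
Qed.

(** With [e11] arbitrary and [e12] nonzero, the trace determines [e22] and the determinant
    determines [e21]. *)
Lemma card_trace_class t : irreducible_trace t ->
  (#|F| * (#|F| - 1) <= #|[set g in SL 2 F | tr2 g == t]|)%N.
Proof.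
move=> irr; pose D := setX [set: F] [set~ (0 : F)].
have -> : (#|F| * (#|F| - 1))%N = #|D| by rewrite cardsX cardsT cardsC1 subn1.
pose h (v : F * F) := gl2 v.1 v.2 ((v.1 * (t - v.1) - 1) / v.2) (t - v.1).
have hdet v : v \in D ->
    v.1 * (t - v.1) - v.2 * ((v.1 * (t - v.1) - 1) / v.2) = 1.
  rewrite !inE /= => v2.
  by rewrite mulrCA divff // mulr1 opprB addrC subrK.
have injh : {in D &, injective h}.
  move=> v w Dv Dw hvw; have [v1 v2 _ _] := gl2E (hdet v Dv).
  have [w1 w2 _ _] := gl2E (hdet w Dw); rewrite -/(h v) -/(h w) in v1 v2 w1 w2.
  by rewrite (surjective_pairing v) (surjective_pairing w) -v1 -w1 -v2 -w2 hvw.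
rewrite -(card_in_imset injh).
apply/subset_leq_card/subsetP=> _ /imsetP[v Dv ->].
have dv := hdet v Dv; rewrite inE gl2_SL //= /tr2.
by have [-> _ _ ->] := gl2E dv; rewrite addrC subrK.
Qed.

(** * Transvections and the upper bound *)

Definition transv s := gl2 1 s 0 1.

Lemma transvE s :
  [/\ e11 (transv s) = 1, e12 (transv s) = s, e21 (transv s) = 0
    & e22 (transv s) = 1].
Proof. by apply: gl2E; ring. Qed.

Lemma transv_SL s : transv s \in SL 2 F.
Proof. by apply: gl2_SL; ring. Qed.

Lemma transv_inj : injective transv.
Proof.
by move=> s t st; have [_ <- _ _] := transvE s; have [_ <- _ _] := transvE t;
  rewrite st.
Qed.

Lemma transv0 : transv 0 = 1%g.
Proof.
have [o11 o12 o21 o22] := GL2_1E F; have [h1 h2 h3 h4] := transvE 0.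
by apply: GL2_eq; congruence.
Qed.

Lemma transvD s t : transv (s + t) = (transv s * transv t)%g.
Proof.
have [s1 s2 s3 s4] := transvE s; have [t1 t2 t3 t4] := transvE t.
have [h1 h2 h3 h4] := transvE (s + t);
  have [p1 p2 p3 p4] := GL2_mulE (transv s) (transv t).
by apply: GL2_eq; rewrite ?p1 ?p2 ?p3 ?p4 ?h1 ?h2 ?h3 ?h4 ?s1 ?s2 ?s3 ?s4 ?t1
  ?t2 ?t3 ?t4 ?mulr0 ?mul0r ?mulr1 ?mul1r ?addr0 ?add0r // addrC.
Qed.

Lemma transv_sqr s : (transv s * transv s)%g = 1%g.
Proof.
rewrite -transvD -transv0; congr transv.
by apply: (lincomb1 (k1 := s) char2); ring.
Qed.

(** This is Cayley-Hamilton with trace 0, determinant 1 and [-1 = 1]. *)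
Lemma sqr_tr2_eq0 y : y \in SL 2 F -> tr2 y = 0 -> (y * y = 1)%g.
Proof.
move=> /SL2P dy ty; have [y1 y2 y3 y4] := GL2_mulE y y.
have [o1 o2 o3 o4] := GL2_1E F; apply: GL2_eq;
  rewrite ?y1 ?y2 ?y3 ?y4 ?o1 ?o2 ?o3 ?o4.
- by apply: (lincomb3 (k1 := -1) (k2 := e11 y) (k3 := -1) dy ty char2);
    rewrite /tr2; ring.
- by apply: (lincomb1 (k1 := e12 y) ty); rewrite /tr2; ring.
- by apply: (lincomb1 (k1 := e21 y) ty); rewrite /tr2; ring.
by apply: (lincomb3 (k1 := -1) (k2 := e22 y) (k3 := -1) dy ty char2);
  rewrite /tr2; ring.
Qed.

(** Conjugation by an upper triangular [y] scales [s] by [e22 y / e11 y], and here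
    [e11 y * e22 y = 1]. *)
Lemma transv_norm y s : y \in SL 2 F -> e21 y = 0 ->
  (transv s ^ y)%g = transv (s * e22 y ^+ 2).
Proof.
move=> /SL2P dy y21; rewrite y21 mulr0 subr0 in dy.
have [s1 s2 s3 s4] := transvE s; have [t1 t2 t3 t4] := transvE (s * e22 y ^+ 2).
apply: (mulgI y); rewrite conjgE mulKVg.
have [l1 l2 l3 l4] := GL2_mulE (transv s) y.
have [r1 r2 r3 r4] := GL2_mulE y (transv (s * e22 y ^+ 2)).
apply: GL2_eq; rewrite ?l1 ?l2 ?l3 ?l4 ?r1 ?r2 ?r3 ?r4 ?s1 ?s2 ?s3 ?s4 ?t1 ?t2
  ?t3 ?t4 ?y21.
- ring.
- by apply: (lincomb1 (k1 := - s * e22 y) dy); ring.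
- ring.
- ring.
Qed.

Lemma solvable_transv y : y \in SL 2 F ->
  exists2 s, s != 0 & solvable <<[set transv s; y]>>%g.
Proof.
move=> Sy; have [y21|y21] := eqVneq (e21 y) 0.
  exists 1; first exact: oner_neq0.
  apply: (@solvable_gen2 _ <<[set transv s | s in F]>>%G).
  - apply: abelian_sol; rewrite abelian_gen.
    apply/centsP=> _ /imsetP[s _ ->] _ /imsetP[t _ ->].
    by rewrite /commute -!transvD addrC.
  - by apply/mem_gen/imsetP; exists 1.
  apply: (subsetP (norm_gen _)); rewrite inE;
    apply/subsetP=> _ /imsetP[_ /imsetP[s _ ->] ->].
  by rewrite transv_norm //; apply: imset_f.
pose s := tr2 y / e21 y.
(* If the trace is 0, the chosen [s] vanishes, but [y] itself squares to 1 and [s = 1] serves. *)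
have [ty|ty] := eqVneq (tr2 y) 0.
  exists 1; first exact: oner_neq0.
  by apply: solvable_gen_involutions; [apply: transv_sqr | apply: sqr_tr2_eq0].
exists s; first by rewrite mulf_neq0 ?invr_eq0.
have Su := transv_SL s; have [s1 s2 s3 s4] := transvE s.
have tu : (transv s * y * (transv s * y))%g = 1%g.
  apply: sqr_tr2_eq0; first exact: groupM.
  have [p1 _ _ p4] := GL2_mulE (transv s) y; rewrite /tr2 p1 p4 s1 s2 s3 s4.
  rewrite /s divfK //; apply: (lincomb1 (k1 := tr2 y) char2); rewrite /tr2;
    ring.
apply: solvableS (solvable_gen_involutions (transv_sqr s) tu).
rewrite gen_subG subUset !sub1set /=.
set H := <<_>>%g; have Hu : transv s \in H by rewrite mem_gen // set21.
by rewrite Hu -(mulKg (transv s) y) groupM ?groupV // mem_gen // set22.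
Qed.

(** Commuting with a lower and an upper transvection forces a scalar matrix, whose square is 1 by
    the determinant. Hence the projection of [SL 2 F] onto [PSL 2 F] is injective. *)
Lemma center_SL2 : 'Z(SL 2 F)%g = 1%g.
Proof.
apply/trivgP/subsetP=> z /centerP[Sz cz]; rewrite inE; apply/eqP.
pose w := gl2 (1 : F) 0 1 1.
have Sw : w \in SL 2 F by apply: gl2_SL; ring.
have [w1 w2 w3 w4] : [/\ e11 w = 1, e12 w = 0, e21 w = 1 & e22 w = 1].
  by apply: gl2E; ring.
have [u1 u2 u3 u4] := transvE 1.
have [zw1 _ zw3 _] := GL2_mulE z w; have [wz1 _ wz3 _] := GL2_mulE w z.
have [zu1 _ _ _] := GL2_mulE z (transv 1);
  have [uz1 _ _ _] := GL2_mulE (transv 1) z.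
have := congr1 (@e11 F) (cz _ Sw); rewrite zw1 wz1 w1 w2 w3 => h1.
have := congr1 (@e21 F) (cz _ Sw); rewrite zw3 wz3 w1 w3 w4 => h2.
have := congr1 (@e11 F) (cz _ (transv_SL 1)); rewrite zu1 uz1 u1 u2 u3 => h3.
have z12 : e12 z = 0 by apply: (lincomb1 (k1 := 1) h1); ring.
have z21 : e21 z = 0 by apply: (lincomb1 (k1 := -1) h3); ring.
have z22 : e22 z = e11 z by apply: (lincomb1 (k1 := 1) h2); ring.
have z11 : e11 z = 1.
  by apply: sqr_inj_char2; move/SL2P: Sz; rewrite z22 z12 mul0r subr0 expr1n.
by have [o1 o2 o3 o4] := GL2_1E F; apply: GL2_eq;
  rewrite ?o1 ?o2 ?o3 ?o4 ?z22 ?z11.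
Qed.

End Char2.

(** * Transfer to the projective group and the two bounds *)

Section Main.

Variable F : finFieldType.
Hypothesis char2 : 2 = 0 :> F.
Hypothesis card_gt2 : (2 < #|F|)%N.

Local Notation Z := ('Z(SL 2 F))%g.

Lemma coset_SL2_inj : {in SL 2 F &, injective (coset Z)}.
Proof.
have inj : ('injm (coset Z))%g by rewrite ker_coset /= center_SL2.
by move=> x y Sx Sy; apply: (injmP inj);
  apply: (subsetP (normal_norm (center_normal _))).
Qed.

Lemma PSL2P x :
  reflect (exists2 x0, x0 \in SL 2 F & x = coset Z x0) (x \in PSL 2 F).
Proof.
apply: (iffP idP) => [/morphimP[x0 _ Sx0 ->] | [x0 Sx0 ->]]; first by exists x0.
by apply: mem_quotient.
Qed.

Lemma solvabilizer_PSL2 x y : x \in SL 2 F -> y \in SL 2 F ->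
  (coset Z y \in solvabilizer (PSL 2 F) (coset Z x))
    = solvable <<[set x; y]>>%g.
Proof.
move=> Sx Sy; rewrite inE mem_quotient //=.
have nZ := subsetP (normal_norm (center_normal (SL_group 2 F))).
by rewrite injm_solvable_gen2 ?nZ // ker_coset /= center_SL2.
Qed.

Lemma card_solvabilizer_PSL2 t x :
  irreducible_trace t -> x \in PSL 2 F -> x != 1%g ->
  (#|[set g in SL 2 F | (tr2 g == t) &&
        (coset Z g \in solvabilizer (PSL 2 F) x)]| <= #|F|)%N.
Proof.
move=> irr /PSL2P[x0 Sx0 ->] x1.
have x01 : x0 != 1%g by apply: contraNneq x1 => ->; rewrite morph1.
apply: leq_trans (card_irreducible_solvabilizer char2 irr Sx0 x01).
apply/subset_leq_card/subsetP=> g; rewrite inE => /and3P[Sg tg].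
by rewrite solvabilizer_PSL2 // inE Sg tg.
Qed.

(** The solvabilizer of a nontrivial [x] in the radical would be the whole group, so the count would
    give [#|F| - 1 <= 1]. *)
Lemma sol_radical_PSL2 x : x \in sol_radical (PSL 2 F) -> x = 1%g.
Proof.
move=> Rx; apply/eqP; apply: contraTT card_gt2 => x1; rewrite -leqNgt.
have [/andP[sRG nRG] solR _] := sol_radicalP (PSL 2 F).
have [t irr] := irreducible_trace_exists char2.
have Gx : x \in PSL 2 F := subsetP sRG x Rx.
have : (#|F| * (#|F| - 1) <= #|F| * 1)%N.
  rewrite muln1; apply: leq_trans (card_trace_class irr) _.
  apply: leq_trans (card_solvabilizer_PSL2 irr Gx x1).
  apply/subset_leq_card/subsetP=> g; rewrite !inE => /andP[Sg ->];
    rewrite Sg /=.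
  have Gg : coset Z g \in PSL 2 F by rewrite mem_quotient ?inE.
  rewrite Gg (@solvable_gen2 _ (sol_radical_group (PSL 2 F))) //=.
  exact: (subsetP nRG).
by rewrite leq_pmul2l ?leq_subLR // (leq_trans _ card_gt2).
Qed.

Lemma sol_covering_card (X : {set coset_of Z}) :
  sol_covering (PSL 2 F) X -> (#|F| - 1 <= #|X|)%N.
Proof.
case/andP=> sXG /eqP covX; have [t irr] := irreducible_trace_exists char2.
have F0 : (0 < #|F|)%N := ltnW (ltnW card_gt2).
rewrite -(leq_pmul2l F0) (leq_trans (card_trace_class irr)) //.
rewrite mulnC -sum_nat_const.
pose S x := [set g in SL 2 F | (tr2 g == t) &&
        (coset Z g \in solvabilizer (PSL 2 F) x)].
apply: (@leq_trans (\sum_(x in X) #|S x|)); last first.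
  (* Lying outside the radical, [x] is nontrivial, so the bound by [#|F|] applies. *)
  apply: leq_sum => x Xx; have := subsetP sXG x Xx; rewrite inE => /andP[Rx Gx].
  apply: card_solvabilizer_PSL2 => //; apply: contraNneq Rx => ->;
    exact: group1.
apply: leq_trans (_ : #|\bigcup_(x in X) S x| <= _)%N; last first.
  elim/big_rec2: _ => [|x n A _ leAn]; first by rewrite cards0.
  by rewrite (leq_trans (leq_card_setU _ _)) ?leq_add2l.
apply/subset_leq_card/subsetP=> g; rewrite inE => /andP[Sg tg].
have : coset Z g \in PSL 2 F by apply: mem_quotient.
rewrite covX => /bigcupP[x Xx gx]; apply/bigcupP; exists x => //.
by rewrite inE Sg tg.
Qed.

Definition transv_cover : {set coset_of Z} :=
  [set coset Z (transv s) | s in [set~ (0 : F)]].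

Lemma card_transv_cover : #|transv_cover| = (#|F| - 1)%N.
Proof.
rewrite card_imset ?cardsC1 ?subn1 // => s t /coset_SL2_inj st.
by apply: transv_inj; apply: st; apply: transv_SL.
Qed.

Lemma transv_coverP : inv_sol_covering (PSL 2 F) transv_cover.
Proof.
have ntr s : s != 0 -> coset Z (transv s) != 1%g.
  apply: contraNneq => s1; apply/eqP/transv_inj; rewrite transv0.
  by apply: coset_SL2_inj; rewrite ?transv_SL ?group1 // morph1.
apply/andP; split; last first.
  apply/forall_inP=> _ /imsetP[s s0 ->]; rewrite !inE in s0.
  have nZ := subsetP (normal_norm (center_normal (SL_group 2 F))).
  apply/eqP/nt_prime_order => //; last exact: ntr.
  by rewrite expgS expg1 -morphM ?nZ ?transv_SL // transv_sqr // morph1.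
have sXG : transv_cover \subset PSL 2 F.
  by apply/subsetP=> _ /imsetP[s _ ->]; apply: mem_quotient; apply: transv_SL.
apply/andP; split.
  apply/subsetP=> x Xx; rewrite inE (subsetP sXG) // andbT.
  apply/negP=> /sol_radical_PSL2 x1; move: Xx; rewrite x1 => /imsetP[s].
  by rewrite !inE => /ntr /eqP s1 /esym.
rewrite eqEsubset; apply/andP; split; last first.
  by apply/bigcupsP=> x _; apply/subsetP=> y; rewrite inE => /andP[].
apply/subsetP=> y Gy; have [y0 Sy0 yE] := PSL2P _ Gy.
have [s s0 sols] := solvable_transv char2 Sy0.
apply/bigcupP; exists (coset Z (transv s)).
  by apply: imset_f; rewrite !inE.
by rewrite yE solvabilizer_PSL2 ?transv_SL.
Qed.

End Main.

Theorem theorem4p4 (p q : nat) (F : finFieldType) :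
  prime p -> q = (2 ^ p)%N -> #|F| = q ->
  (exists2 X : {set coset_of 'Z(SL 2 F)},
      inv_sol_covering (PSL 2 F) X & #|X| = (q - 1)%N) /\
  inv_sol_number (PSL 2 F) = Some (q - 1)%N /\
  sol_number (PSL 2 F) = Some (q - 1)%N.
Proof.
move=> p_pr qE cardF.
have char2 : 2 = 0 :> F.
  by apply/eqP; case/andP: (card_finPcharP (etrans cardF qE) (isT : prime 2)).
(* A prime is at least 2, so [q] is at least 4. *)
have card_gt2 : (2 < #|F|)%N.
  by rewrite cardF qE; apply: (@leq_trans (2 ^ 2));
    rewrite ?leq_pexp2l ?prime_gt1.
have covX := transv_coverP char2 card_gt2.
have cardX : #|transv_cover F| = (q - 1)%N.
  by rewrite card_transv_cover // cardF.
(* This bound serves both numbers, as involutionary coverings are coverings. *)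
have minX Y : sol_covering (PSL 2 F) Y -> (q - 1 <= #|Y|)%N.
  by rewrite -cardF; apply: sol_covering_card.
split; first by exists (transv_cover F).
split; apply/min_cardP; split=> [|Y].
- by exists (transv_cover F).
- by case/andP=> /minX.
- by exists (transv_cover F) => //; case/andP: covX.
exact: minX.
Qed.
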